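(* There is a computable type 2 tree $T$ such that every nontrivial self-embedding of $T$ computes $0'$.
   Context: A tree is a partial order $(T,\preceq)$ with a least element (the root) such that for every $n\in T$ the set $\{m\in T: m\preceq n\}$ is finite and linearly ordered; all trees are countable. A tree is computable if $T\subseteq\omega$ is computable and $\preceq$ is computable. An embedding between trees is an injective map $f$ with $n\preceq m$ iff $f(n)\preceq f(m)$; a self-embedding is nontrivial if it is not onto. For $n\in T$, $T(n)=\{m: n\preceq m\}$; $n$ is a maximal infinite node if $T(n)$ is infinite but $T(m)$ is finite for all $m\succ n$. A path is an infinite maximal linearly ordered subset; it is isolated if some node on it lies on no other path. $T$ is of type 2 if it has no maximal infinite node but has an isolated path. $0'$ is the halting set. *)

(* Defs.v *)
From Stdlib Require Cantor.
From mathcomp Require Import all_boot.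
From mathcomp Require Import boolp classical_sets functions cardinality.

Set Implicit Arguments.
Unset Strict Implicit.
Unset Printing Implicit Defensive.

Local Open Scope classical_set_scope.

Definition cpair (x y : nat) : nat := Cantor.to_nat (x, y).
Definition cfst (n : nat) : nat := (Cantor.of_nat n).1.
Definition csnd (n : nat) : nat := (Cantor.of_nat n).2.

(** Programs for the partial recursive functions of one variable relative to an
    oracle; functions of several variables are obtained through [cpair].
    [Prec f g] is h(<a,0>) = f(a), h(<a,n+1>) = g(<a,<n,h(<a,n>)>>), and
    [Mu f] maps x to the least n such that f(<x,n>) = 0, where f(<x,m>) has to
    be defined for all m < n. *)
Inductive code : Set :=
| Zero
| Succ
| Fst
| Snd
| Oracle
| Pair of code & code
| Comp of code & code
| Prec of code & code
| Mu of code.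

(** [eval O c x y] : the program [c] with oracle [O] halts on input [x] with
    output [y]. *)
Fixpoint eval (O : nat -> nat) (c : code) : nat -> nat -> Prop :=
  match c with
  | Zero => fun _ y => y = 0
  | Succ => fun x y => y = x.+1
  | Fst => fun x y => y = cfst x
  | Snd => fun x y => y = csnd x
  | Oracle => fun x y => y = O x
  | Pair f g => fun x y =>
      exists u v, [/\ eval O f x u, eval O g x v & y = cpair u v]
  | Comp f g => fun x y => exists2 u, eval O g x u & eval O f u y
  | Prec f g => fun x =>
      nat_rect (fun _ => nat -> Prop)
        (eval O f (cfst x))
        (fun n h y =>
           exists2 r, h r & eval O g (cpair (cfst x) (cpair n r)) y)
        (csnd x)
  | Mu f => fun x n =>
      eval O f (cpair x n) 0 /\
      forall m, m < n -> exists k, eval O f (cpair x m) k.+1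
  end.

Fixpoint encode (c : code) : nat :=
  match c with
  | Zero => cpair 0 0
  | Succ => cpair 1 0
  | Fst => cpair 2 0
  | Snd => cpair 3 0
  | Oracle => cpair 4 0
  | Pair f g => cpair 5 (cpair (encode f) (encode g))
  | Comp f g => cpair 6 (cpair (encode f) (encode g))
  | Prec f g => cpair 7 (cpair (encode f) (encode g))
  | Mu f => cpair 8 (encode f)
  end.

Lemma cpair_inj x y u v : cpair x y = cpair u v -> x = u /\ y = v.
Proof. by move/Cantor.to_nat_inj => [-> ->]. Qed.

Lemma encode_inj : injective encode.
Proof.
elim=> [||||| f IHf g IHg | f IHf g IHg | f IHf g IHg | f IHf]
       [||||| f' g' | f' g' | f' g' | f'] //= /cpair_inj [] // _.
- by move=> /cpair_inj [/IHf-> /IHg->].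
- by move=> /cpair_inj [/IHf-> /IHg->].
- by move=> /cpair_inj [/IHf-> /IHg->].
- by move=> /IHf->.
Qed.

Lemma eval_functional O c x y z : eval O c x y -> eval O c x z -> y = z.
Proof.
elim: c x y z => [||||| f IHf g IHg | f IHf g IHg | f IHf g IHg | f IHf] x y z
  /=; try by move=> -> ->.
- move=> [u [v [fu gv ->]]] [u' [v' [fu' gv' ->]]].
  by rewrite (IHf _ _ _ fu fu') (IHg _ _ _ gv gv').
- by move=> [u gu fy] [u' /(IHg _ _ _ gu) <- /(IHf _ _ _ fy)].
- elim: (csnd x) y z => [|n IHn] y z /=; first exact: IHf.
  by move=> [r hr gy] [r' /(IHn _ _ hr) <- /(IHg _ _ _ gy)].
- move=> [fy Hy] [fz Hz]; case: (ltngtP y z) => // [yz|zy].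
  + by have [k /(IHf _ _ _ fy)] := Hz _ yz.
  + by have [k /(IHf _ _ _ fz)] := Hy _ zy.
Qed.

(** Decidability of [A] relative to the oracle [O], i.e. [A] is Turing reducible
    to [O]. *)
Definition computable_in (O : nat -> nat) (A : set nat) : Prop :=
  exists c, forall n, (A n -> eval O c n 1) /\ (~ A n -> eval O c n 0).

Definition no_oracle : nat -> nat := fun=> 0.

Definition computable_set (A : set nat) : Prop := computable_in no_oracle A.

Definition halting_set : set nat :=
  [set e | exists c, encode c = e /\ exists y, eval no_oracle c e y].

(** A self-map of [T], extended by 0 outside [T]: for computable [T] this total
    function has the same Turing degree as the graph of the map. *)
Definition extend0 (T : set nat) (f : T -> T) (n : nat) : nat :=
  if insub n is Some x then val (f x) else 0.

Definition computes (T : set nat) (f : T -> T) (A : set nat) : Prop :=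
  computable_in (extend0 f) A.

Section Trees.
Context {X : Type} (le : rel X).

Definition linearly_ordered (P : set X) : Prop :=
  forall x y, P x -> P y -> le x y \/ le y x.

Definition is_tree : Prop :=
  [/\ [/\ reflexive le, antisymmetric le & transitive le],
      countable [set: X],
      exists root, forall n, le root n
    & forall n, finite_set [set m | le m n] /\
                linearly_ordered [set m | le m n]].

Definition cone (n : X) : set X := [set m | le n m].

Definition maximal_infinite_node (n : X) : Prop :=
  infinite_set (cone n) /\
  forall m, le n m -> m <> n -> finite_set (cone m).

Definition is_path (P : set X) : Prop :=
  [/\ infinite_set P, linearly_ordered P
    & forall Q : set X, linearly_ordered Q -> P `<=` Q -> Q = P].

Definition isolated_path (P : set X) : Prop :=
  is_path P /\
  exists n, P n /\ forall Q : set X, is_path Q -> Q n -> Q = P.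

Definition type2 : Prop :=
  ~ (exists n, maximal_infinite_node n) /\ exists P, isolated_path P.

End Trees.

Definition embedding {X Y : Type} (leX : rel X) (leY : rel Y) (f : X -> Y) :
  Prop := injective f /\ forall n m, leX n m <-> leY (f n) (f m).

Definition nontrivial_self_embedding {X : Type} (le : rel X) (f : X -> X) :
  Prop := embedding le le f /\ range f <> [set: X].

Definition computable_tree (T : set nat) (le : rel T) : Prop :=
  [/\ is_tree le,
      computable_set T
    & computable_set
        [set p | exists n m : T, le n m /\ p = cpair (val n) (val m)]].

(* Main.v *)
Require Import Defs.
From mathcomp Require Import all_boot zify.
From mathcomp Require Import boolp classical_sets functions cardinality.

(** Let [a] enumerate injectively a set of the degree of the halting set, and
    call [s] a true stage if [a t > a s] for all [t > s]. The tree consists of a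
    path p_0 < p_1 < ... with a finite chain attached at each p_i, of length
    s - i where s is the least true stage >= i; it is computable because an
    element is added to a chain only when a stage is seen not to be true. A
    self-embedding maps the path into itself, p_i to p_(g i), and the chain at
    p_i into a chain at some p_j with g i <= j < g (i+1). If it is nontrivial,
    then g i > i from some i on, and the chain at p_j can be long enough only if
    there is a true stage in [i, j]. Iterating g therefore bounds arbitrarily
    many true stages, and these give bounds on when small numbers are
    enumerated. *)

Set Implicit Arguments.
Unset Strict Implicit.
Unset Printing Implicit Defensive.

Local Arguments cpair : simpl never.
Local Arguments cfst : simpl never.
Local Arguments csnd : simpl never.

(** * Total computable functions *)

Lemma cfst_cpair x y : cfst (cpair x y) = x.
Proof. by rewrite /cfst /cpair Cantor.cancel_of_to. Qed.

Lemma csnd_cpair x y : csnd (cpair x y) = y.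
Proof. by rewrite /csnd /cpair Cantor.cancel_of_to. Qed.

Lemma cpair_eta z : cpair (cfst z) (csnd z) = z.
Proof.
by rewrite /cpair /cfst /csnd -surjective_pairing Cantor.cancel_to_of.
Qed.

Lemma leq_cpair x y : x + y <= cpair x y.
Proof. by rewrite /cpair; have := Cantor.to_nat_non_decreasing x y; lia. Qed.

Section TotalComputable.
Context (O : nat -> nat).
Implicit Types (f g h : nat -> nat) (P Q : nat -> bool).

Definition tcomp f : Prop := exists c, forall x, eval O c x (f x).
Definition tdec P : Prop := tcomp (fun x => nat_of_bool (P x)).

Lemma tcomp_ext f g : f =1 g -> tcomp g -> tcomp f.
Proof. by move=> fg [c cg]; exists c => x; rewrite fg. Qed.

Lemma tcomp_pair f g : tcomp f -> tcomp g -> tcomp (fun x => cpair (f x) (g x)).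
Proof.
by move=> [c cf] [d dg]; exists (Pair c d) => x; exists (f x), (g x).
Qed.

Lemma tcomp_comp f g : tcomp f -> tcomp g -> tcomp (fun x => f (g x)).
Proof. by move=> [c cf] [d dg]; exists (Comp c d) => x; exists (g x). Qed.

Lemma tcomp_cfst g : tcomp g -> tcomp (fun x => cfst (g x)).
Proof. by apply: (@tcomp_comp cfst); exists Fst. Qed.

Lemma tcomp_csnd g : tcomp g -> tcomp (fun x => csnd (g x)).
Proof. by apply: (@tcomp_comp csnd); exists Snd. Qed.

Lemma tcomp_succ g : tcomp g -> tcomp (fun x => (g x).+1).
Proof. by apply: (@tcomp_comp succn); exists Succ. Qed.

Lemma tcomp_oracle g : tcomp g -> tcomp (fun x => O (g x)).
Proof. by apply: tcomp_comp; exists Oracle. Qed.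

(** No program constructor is the identity, so it is rebuilt from the two projections. *)
Lemma tcomp_id : tcomp id.
Proof.
apply: (@tcomp_ext _ (fun x => cpair (cfst x) (csnd x))).
  by move=> x; rewrite cpair_eta.
by apply: tcomp_pair; [exists Fst | exists Snd].
Qed.

Lemma tcomp_const n : tcomp (fun=> n).
Proof. by elim: n => [|n]; [exists Zero | apply: tcomp_succ]. Qed.

Lemma tcomp_rec f (g : nat -> nat -> nat -> nat) h :
    tcomp f -> tcomp (fun x => g (cfst x) (cfst (csnd x)) (csnd (csnd x))) ->
    tcomp h ->
  tcomp (fun x => nat_rect (fun=> nat) (f x) (fun n r => g x n r) (h x)).
Proof.
move=> [c cf] [d dg] th.
(* [Prec] recurses on the second half of its own input, so the recursion is run on a pair [z] and
   then composed with the map from [x] to the pair of [x] and [h x]. *)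
pose F z :=
  nat_rect (fun=> nat) (f (cfst z)) (fun n r => g (cfst z) n r) (csnd z).
apply: (@tcomp_ext _ (fun x => F (cpair x (h x)))).
  by move=> x; rewrite /F cfst_cpair csnd_cpair.
apply: (@tcomp_comp F); last exact: tcomp_pair tcomp_id th.
exists (Prec c d) => z /=; rewrite /F; elim: (csnd z) => //= n IHn.
exists (nat_rect (fun=> nat) (f (cfst z)) (fun n r => g (cfst z) n r) n) => //.
by have := dg (cpair (cfst z) (cpair n (nat_rect (fun=> nat) (f (cfst z))
  (fun n r => g (cfst z) n r) n))); rewrite !(cfst_cpair, csnd_cpair).
Qed.

Lemma tcomp_iter f g h : tcomp f -> tcomp g -> tcomp h ->
  tcomp (fun x => iter (h x) f (g x)).
Proof.
move=> tf tg th.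
apply: (tcomp_ext _ (@tcomp_rec g (fun _ _ r => f r) h tg _ th)) => [x|].
  by elim: (h x) => //= n ->.
by apply: tcomp_comp tf _; do 2![apply: tcomp_csnd]; apply: tcomp_id.
Qed.

(** A truth value is 0 or 1, so a recursion of that length makes the choice. *)
Lemma tcomp_if P f g : tdec P -> tcomp f -> tcomp g ->
  tcomp (fun x => if P x then f x else g x).
Proof.
move=> tP tf tg.
apply: (tcomp_ext _
  (@tcomp_rec g (fun x _ _ => f x) (fun x => P x) tg _ tP)) => [x|].
  by case: (P x).
by apply: tcomp_comp tf _; apply: tcomp_cfst; apply: tcomp_id.
Qed.

Lemma tcomp_predn g : tcomp g -> tcomp (fun x => (g x).-1).
Proof.
move=> tg; apply: (tcomp_ext _
  (@tcomp_rec (fun=> 0) (fun _ n _ => n) g (tcomp_const 0) _ tg)) => [x|].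
  by case: (g x).
by apply: tcomp_cfst; apply: tcomp_csnd; apply: tcomp_id.
Qed.

Lemma tcomp_addn f g : tcomp f -> tcomp g -> tcomp (fun x => f x + g x).
Proof.
move=> tf tg; apply: (tcomp_ext _ (tcomp_iter _ tf tg)); last first.
  by exact: (tcomp_succ tcomp_id).
by move=> x; rewrite addnC; elim: (g x) => //= n <-.
Qed.

Lemma tcomp_subn f g : tcomp f -> tcomp g -> tcomp (fun x => f x - g x).
Proof.
move=> tf tg; apply: (tcomp_ext _ (tcomp_iter _ tf tg)); last first.
  by exact: (tcomp_predn tcomp_id).
by move=> x; elim: (g x) => [|n /= <-]; rewrite ?subn0 ?subnS.
Qed.

Lemma tdec_neg P : tdec P -> tdec (fun x => ~~ P x).
Proof.
move=> tP; apply: tcomp_ext (tcomp_if tP (tcomp_const 0) (tcomp_const 1)).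
by move=> x; case: (P x).
Qed.

Lemma tdec_and P Q : tdec P -> tdec Q -> tdec (fun x => P x && Q x).
Proof.
move=> tP tQ; apply: tcomp_ext (tcomp_if tP tQ (tcomp_const 0)).
by move=> x; case: (P x).
Qed.

Lemma tdec_or P Q : tdec P -> tdec Q -> tdec (fun x => P x || Q x).
Proof.
move=> tP tQ; apply: tcomp_ext (tcomp_if tP (tcomp_const 1) tQ).
by move=> x; case: (P x).
Qed.

Lemma tdec_leq f g : tcomp f -> tcomp g -> tdec (fun x => f x <= g x).
Proof.
move=> tf tg; have := @tcomp_rec (fun=> 1) (fun _ _ _ => 0) _
  (tcomp_const 1) (tcomp_const 0) (tcomp_subn tf tg).
by apply: tcomp_ext => x; rewrite /leq; case: (f x - g x).
Qed.

Lemma tdec_eqn f g : tcomp f -> tcomp g -> tdec (fun x => f x == g x).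
Proof.
move=> tf tg; apply: tcomp_ext (tdec_and (tdec_leq tf tg) (tdec_leq tg tf)).
by move=> x; rewrite eqn_leq.
Qed.

Lemma tdec_all (P : nat -> nat -> bool) h :
    tdec (fun x => P (cfst x) (csnd x)) -> tcomp h ->
  tdec (fun x => all (fun n => P x n) (iota 0 (h x))).
Proof.
move=> tP th; apply: (tcomp_ext _ (@tcomp_rec (fun=> 1)
  (fun x n r => if P x n then r else 0) h (tcomp_const 1) _ th)) => [x|].
  elim: (h x) => // n IHn.
  have -> : iota 0 n.+1 = iota 0 n ++ [:: n] by rewrite -addn1 iotaD.
  by rewrite [RHS]/= -IHn all_cat andbC /= andbT; case: (P x n).
apply: tcomp_if; last exact: tcomp_const.
  pose k x := cpair (cfst x) (cfst (csnd x)).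
  apply: (tcomp_ext _ (tcomp_comp (g := k) tP _)) => [x|].
    by rewrite /k cfst_cpair csnd_cpair.
  apply: tcomp_pair; do ?apply: tcomp_cfst; do ?apply: tcomp_csnd;
    exact: tcomp_id.
by do 2!apply: tcomp_csnd; apply: tcomp_id.
Qed.

Lemma tdec_has (P : nat -> nat -> bool) h :
    tdec (fun x => P (cfst x) (csnd x)) -> tcomp h ->
  tdec (fun x => has (fun n => P x n) (iota 0 (h x))).
Proof.
move=> tP th; apply: tcomp_ext
  (tdec_neg (@tdec_all (fun x n => ~~ P x n) h (tdec_neg tP) th)) => x.
by rewrite -has_predC; congr nat_of_bool; apply: eq_has => n /=; rewrite negbK.
Qed.

End TotalComputable.

(** * Coding of finite sequences by numbers *)

Definition nth_code (l j : nat) : nat := cfst (iter j csnd l).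

Definition decode_seq (w : nat) : seq nat :=
  [seq nth_code (csnd w) j | j <- iota 0 (cfst w)].

(** The length comes first because nested pairs do not show their end: [0] is itself [cpair 0 0]. *)
Definition encode_seq (s : seq nat) : nat := cpair (size s) (foldr cpair 0 s).

Lemma encode_seqK : cancel encode_seq decode_seq.
Proof.
move=> s; rewrite /decode_seq /encode_seq cfst_cpair csnd_cpair.
elim: s => //= x s IHs; rewrite /nth_code /= cfst_cpair; congr (_ :: _).
rewrite -[in RHS]IHs (iotaDl 1 0) -map_comp; apply: eq_map => j /=.
by rewrite /nth_code -iterS iterSr csnd_cpair.
Qed.

Section DecodedSequences.
Context (O : nat -> nat).

Lemma tcomp_nth_code f g : tcomp O f -> tcomp O g ->
  tcomp O (fun x => nth_code (f x) (g x)).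
Proof.
move=> tf tg; apply: tcomp_cfst; apply: tcomp_iter => //.
by apply: tcomp_csnd; apply: tcomp_id.
Qed.

Lemma tdec_subst (P : nat -> nat -> bool) f g :
    tdec O (fun x => P (cfst x) (csnd x)) -> tcomp O f -> tcomp O g ->
  tdec O (fun x => P (f x) (g x)).
Proof.
move=> tP tf tg; have := tcomp_comp tP (tcomp_pair tf tg).
by apply: tcomp_ext => x; rewrite cfst_cpair csnd_cpair.
Qed.

Lemma tdec_all_decode (P : nat -> nat -> bool) h :
    tdec O (fun x => P (cfst x) (csnd x)) -> tcomp O h ->
  tdec O (fun x => all (fun n => P x n) (decode_seq (h x))).
Proof.
move=> tP th.
apply: (tcomp_ext _ (@tdec_all O (fun x j => P x (nth_code (csnd (h x)) j))
  (fun x => cfst (h x)) _ (tcomp_cfst th))) => [x|].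
  by rewrite /decode_seq all_map.
apply: tdec_subst tP _ _; first exact: tcomp_cfst (tcomp_id _).
apply: tcomp_nth_code; last exact: tcomp_csnd (tcomp_id _).
by apply: tcomp_csnd; apply: tcomp_comp th _; apply: tcomp_cfst (tcomp_id _).
Qed.

Lemma tdec_has_decode (P : nat -> nat -> bool) h :
    tdec O (fun x => P (cfst x) (csnd x)) -> tcomp O h ->
  tdec O (fun x => has (fun n => P x n) (decode_seq (h x))).
Proof.
move=> tP th; apply: tcomp_ext
  (tdec_neg (@tdec_all_decode (fun x n => ~~ P x n) h (tdec_neg tP) th)) => x.
by rewrite -has_predC; congr nat_of_bool; apply: eq_has => n /=; rewrite negbK.
Qed.

Lemma tdec_mem_decode f h : tcomp O f -> tcomp O h ->
  tdec O (fun x => f x \in decode_seq (h x)).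
Proof.
move=> tf th; apply: (tcomp_ext _
  (@tdec_has_decode (fun x n => n == f x) h _ th)) => [x|].
  by rewrite -has_pred1.
apply: tdec_eqn; first exact: tcomp_csnd (tcomp_id _).
by apply: tcomp_comp tf _; apply: tcomp_cfst (tcomp_id _).
Qed.

End DecodedSequences.

(** * Syntax-directed proofs of computability *)

Ltac tcomp_step :=
  unfold tdec; cbv beta;
  lazymatch goal with
  | |- tcomp _ (fun=> ?c) => apply: tcomp_const
  | |- tcomp _ (fun x => x) => exact: tcomp_id
  | |- tcomp _ (fun x => cfst _) => apply: tcomp_cfst
  | |- tcomp _ (fun x => csnd _) => apply: tcomp_csnd
  | |- tcomp _ S => exact: tcomp_succ (tcomp_id _)
  | |- tcomp _ cfst => exact: tcomp_cfst (tcomp_id _)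
  | |- tcomp _ csnd => exact: tcomp_csnd (tcomp_id _)
  | |- tcomp _ (fun x => cpair _ _) => apply: tcomp_pair
  | |- tcomp _ (fun x => _.+1) => apply: tcomp_succ
  | |- tcomp _ (fun x => _.-1) => apply: tcomp_predn
  | |- tcomp _ (fun x => _ + _) => apply: tcomp_addn
  | |- tcomp _ (fun x => _ - _) => apply: tcomp_subn
  | |- tcomp _ (fun x => nat_of_bool (~~ _)) => apply: tdec_neg
  | |- tcomp _ (fun x => nat_of_bool (_ && _)) => apply: tdec_and
  | |- tcomp _ (fun x => nat_of_bool (_ || _)) => apply: tdec_or
  | |- tcomp _ (fun x => nat_of_bool (_ <= _)) => apply: tdec_leq
  | |- tcomp _ (fun x => nat_of_bool (_ == _)) => apply: tdec_eqn
  | |- tcomp _ (fun x => nat_of_bool (_ \in decode_seq _)) =>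
      apply: tdec_mem_decode
  | |- tcomp _ (fun x => nat_of_bool (all (@?P x) (iota 0 (@?h x)))) =>
      apply: (@tdec_all _ P h)
  | |- tcomp _ (fun x => nat_of_bool (has (@?P x) (iota 0 (@?h x)))) =>
      apply: (@tdec_has _ P h)
  | |- tcomp _ (fun x => nat_of_bool (all (@?P x) (decode_seq (@?h x)))) =>
      apply: (@tdec_all_decode _ P h)
  | |- tcomp _ (fun x => nat_of_bool (has (@?P x) (decode_seq (@?h x)))) =>
      apply: (@tdec_has_decode _ P h)
  | |- tcomp _ (fun x => if _ then _ else _) => apply: tcomp_if
  end.
Ltac tcomp_auto := repeat (tcomp_step; cbv beta).

(** * Enumerability of the halting set *)

(** The fact [iscode e] claims that [e] encodes a program, and [halts e x y]
    that this program, with oracle [no_oracle], maps [x] to [y]. *)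
Definition iscode (e : nat) : nat := cpair 0 (cpair e 0).
Definition halts (e x y : nat) : nat := cpair 1 (cpair e (cpair x y)).

Definition tag (t : nat) : nat := cfst t.
Definition prog (t : nat) : nat := cfst (csnd t).
Definition inp (t : nat) : nat := cfst (csnd (csnd t)).
Definition out (t : nat) : nat := csnd (csnd (csnd t)).

Lemma prog_iscode e : prog (iscode e) = e.
Proof. by rewrite /prog /iscode csnd_cpair cfst_cpair. Qed.

Lemma haltsE e x y :
  [/\ tag (halts e x y) = 1, prog (halts e x y) = e,
      inp (halts e x y) = x & out (halts e x y) = y].
Proof. by rewrite /tag /prog /inp /out !(csnd_cpair, cfst_cpair). Qed.

(** Halting facts alone would not show that [e] encodes a program: a [Prec] run with recursion
    argument 0 never looks at its second part. *)
Definition code_justified (s : seq nat) (e : nat) : bool :=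
  [|| (cfst e <= 4) && (csnd e == 0),
      [&& 5 <= cfst e, cfst e <= 7, iscode (cfst (csnd e)) \in s
        & iscode (csnd (csnd e)) \in s]
    | (cfst e == 8) && (iscode (csnd e) \in s)].

(** One disjunct per constructor, two for [Prec]. Intermediate values are searched only among the
    outputs of facts in [s], which keeps the test decidable. *)
Definition halts_justified (s : seq nat) (e x y : nat) : bool :=
  (e == cpair 0 0) && (y == 0)
  || (e == cpair 1 0) && (y == x.+1)
  || (e == cpair 2 0) && (y == cfst x)
  || (e == cpair 3 0) && (y == csnd x)
  || (e == cpair 4 0) && (y == 0)
  || [&& cfst e == 5, halts (cfst (csnd e)) x (cfst y) \in s
       & halts (csnd (csnd e)) x (csnd y) \in s]
  || (cfst e == 6) &&
     has (fun t => (halts (csnd (csnd e)) x (out t) \in s) &&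
                   (halts (cfst (csnd e)) (out t) y \in s)) s
  || [&& cfst e == 7, csnd x == 0 & halts (cfst (csnd e)) (cfst x) y \in s]
  || [&& cfst e == 7, 1 <= csnd x &
      has (fun t =>
        (halts e (cpair (cfst x) (csnd x).-1) (out t) \in s) &&
        (halts (csnd (csnd e)) (cpair (cfst x) (cpair (csnd x).-1 (out t))) y
           \in s)) s]
  || [&& cfst e == 8, halts (csnd e) (cpair x y) 0 \in s &
      all (fun m => has (fun t =>
        (1 <= out t) && (halts (csnd e) (cpair x m) (out t) \in s)) s)
        (iota 0 y)].

(** Facts may be justified by each other in any order: [eval] is defined by
    recursion on the program, and on the argument for [Prec], so that soundness
    follows by the same recursion. *)
Definition justified (s : seq nat) (t : nat) : bool :=
  (tag t == 0) && code_justified s (prog t)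
  || (tag t != 0) && halts_justified s (prog t) (inp t) (out t).

Definition certificate (s : seq nat) : bool := all (justified s) s.

Definition halting_witness (e w : nat) : bool :=
  [&& certificate (decode_seq w), iscode e \in decode_seq w
    & has (fun t => halts e e (out t) \in decode_seq w) (decode_seq w)].

Lemma tdec_halting_witness O f g : tcomp O f -> tcomp O g ->
  tdec O (fun x => halting_witness (f x) (g x)).
Proof.
apply: tdec_subst.
rewrite /halting_witness /certificate /justified /code_justified.
rewrite /halts_justified /halts /iscode /tag /prog /inp /out.
by tcomp_auto.
Qed.

(** * Soundness of certificates *)

Lemma code_justified_sound (s : seq nat) e :
  {in s, forall t, justified s t} -> iscode e \in s ->
  exists c, encode c = e.
Proof.
move=> cert; elim/ltn_ind: e => e IHe /cert.
rewrite /justified prog_iscode /tag /iscode cfst_cpair /= orbF /code_justified.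
have /= := cpair_eta e; move: (cfst e) (csnd e) => o p ep.
(* A pair is only weakly above its components; the positive tag makes the descent strict. *)
have ltp : 0 < o -> p < e by have := leq_cpair o p; lia.
have /= := cpair_eta p; move: (cfst p) (csnd p) => f g fp.
have := leq_cpair f g => lefg.
case/or3P => [/andP[o4 /eqP p0]|/and4P[o5 o7 cf cg]|/andP[/eqP o8 cp]].
- rewrite -ep p0; case: o o4 {ep ltp} => [|[|[|[|[|o]]]]] // _.
  + by exists Zero.
  + by exists Succ.
  + by exists Fst.
  + by exists Snd.
  + by exists Oracle.
- have [|c Ec] := IHe f _ cf; first by lia.
  have [|d Ed] := IHe g _ cg; first by lia.
  have : [\/ o = 5, o = 6 | o = 7].
    by case: o o5 o7 {ep ltp} => [|[|[|[|[|[|[|[|o]]]]]]]] // _ _;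
      [constructor 1 | constructor 2 | constructor 3].
  rewrite -ep -fp -Ec -Ed => -[] ->.
  + by exists (Pair c d).
  + by exists (Comp c d).
  + by exists (Prec c d).
- have [|c Ec] := IHe p _ cp; first by lia.
  by exists (Mu c); rewrite -ep -Ec o8.
Qed.

Lemma halts_justified_sound (s : seq nat) c x y :
  {in s, forall t, justified s t} -> halts (encode c) x y \in s ->
  eval no_oracle c x y.
Proof.
move=> cert.
have {cert} cert e x' y' : halts e x' y' \in s -> halts_justified s e x' y'.
  by move=> /cert; rewrite /justified; have [-> -> -> ->] := haltsE e x' y'.
(* With distinct tags, the atomic disjuncts of the other constructors reduce to false. *)
have tagF i j p q (B : bool) : i != j -> (cpair i p == cpair j q) && B = false.
  by move=> ij; apply/andP => -[/eqP/cpair_inj[/eqP]]; rewrite (negPf ij).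
elim: c x y => [||||| f IHf g IHg | f IHf g IHg | f IHf g IHg | f IHf] x y H;
  have := cert _ _ _ H;
  rewrite /halts_justified /= ?(cfst_cpair, csnd_cpair) ?tagF //= ?orbF.
- by move/eqP.
- by move/eqP.
- by move/eqP.
- by move/eqP.
- by move/eqP.
- case/andP => /IHf Hf /IHg Hg.
  by exists (cfst y), (csnd y); rewrite cpair_eta.
- by case/hasP => t _ /andP[/IHg Hg /IHf Hf]; exists (out t).
(* A [Prec] fact refers to the same program at a smaller argument, hence the inner induction on
   [n]. *)
- move=> _; move E: (csnd x) => n; elim: n x y E H => [|n IHn] x y E /cert;
    rewrite /halts_justified /= ?(cfst_cpair, csnd_cpair) ?tagF //= E /= ?orbF.
    by move/IHf.
  case/hasP => t _ /andP[Ht /IHg Hg]; exists (out t) => //.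
  by have := IHn _ _ _ Ht; rewrite !(cfst_cpair, csnd_cpair); apply.
- case/andP => /IHf Hf /allP Hm; split=> // m ltmy.
  have my : m \in iota 0 y by rewrite mem_iota.
  have /hasP[t _ /andP[t0 /IHf Ht]] := Hm m my.
  by exists (out t).-1; rewrite prednK.
Qed.

(** * Completeness of certificates *)

Lemma sub_code_justified (s s' : seq nat) e : {subset s <= s'} ->
  code_justified s e -> code_justified s' e.
Proof.
move=> ss'; rewrite /code_justified.
case/or3P=> [->//|/and4P[-> -> /ss'-> /ss'->]|/andP[-> /ss'->]];
  by rewrite ?orbT.
Qed.

(** Facts are only ever required to be present in [s], never to be absent. *)
Lemma sub_halts_justified (s s' : seq nat) e x y : {subset s <= s'} ->
  halts_justified s e x y -> halts_justified s' e x y.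
Proof.
move=> ss'.
have subhas (P Q : pred nat) : subpred P Q -> has P s -> has Q s'.
  by move=> PQ /hasP[t ts Pt]; apply/hasP; exists t; [exact: ss' | exact: PQ].
rewrite /halts_justified; do ![case/orP].
- by move=> ->.
- by move=> ->; rewrite ?orbT.
- by move=> ->; rewrite ?orbT.
- by move=> ->; rewrite ?orbT.
- by move=> ->; rewrite ?orbT.
- by case/and3P=> -> /ss'-> /ss'->; rewrite ?orbT.
- case/andP=> -> H; rewrite (subhas _ _ _ H) ?orbT //.
  by move=> t /andP[/ss'-> /ss'->].
- by case/and3P=> -> -> /ss'->; rewrite ?orbT.
- case/and3P=> -> -> H; apply/orP; left; apply/orP; right.
  by apply: subhas H => t /andP[/ss'-> /ss'->].
- case/and3P=> -> /ss'-> /allP H; apply/orP; right.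
  by apply/allP => m /H; apply: subhas => t /andP[-> /ss'->].
Qed.

Lemma sub_justified (s s' : seq nat) t : {subset s <= s'} ->
  justified s t -> justified s' t.
Proof.
move=> ss' /orP[] /andP[t0 J]; apply/orP; [left|right]; rewrite t0.
  exact: sub_code_justified J.
exact: sub_halts_justified J.
Qed.

Definition certified (t : nat) : Prop := exists2 s, certificate s & t \in s.

(** Certificates can be concatenated, since justification is monotone. *)
Lemma certified_all (l : seq nat) : {in l, forall t, certified t} ->
  exists2 s, certificate s & {subset l <= s}.
Proof.
elim: l => [|t l IHl] H; first by exists [::].
have [|s s_cert ls] := IHl; first by move=> u ul; apply: H; rewrite inE ul orbT.
have [|s' s'_cert ts'] := H t; first by rewrite inE eqxx.
exists (s ++ s'); last first.
  by move=> u; rewrite inE mem_cat => /orP[/eqP->|/ls->]; rewrite ?ts' ?orbT.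
rewrite /certificate all_cat; apply/andP; split.
  apply: sub_all s_cert => u; apply: sub_justified => v vs.
  by rewrite mem_cat vs.
apply: sub_all s'_cert => u; apply: sub_justified => v vs'.
by rewrite mem_cat vs' orbT.
Qed.

Lemma certified_justified (l : seq nat) t :
  {in l, forall u, certified u} -> justified l t -> certified t.
Proof.
move=> /certified_all[s s_cert ls] lt; exists (t :: s); last first.
  by rewrite inE eqxx.
have sts : {subset s <= t :: s} by move=> u us; rewrite inE us orbT.
rewrite /certificate /= (sub_justified _ lt) /=; last by move=> u /ls/sts.
by apply: sub_all s_cert => u; apply: sub_justified.
Qed.

Lemma certified_code c : certified (iscode (encode c)).
Proof.
elim: c => [||||| f IHf g IHg | f IHf g IHg | f IHf g IHg | f IHf].
6-8: apply: (@certified_justified [:: iscode (encode f); iscode (encode g)]);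
  first (by move=> t; rewrite !inE => /orP[]/eqP->);
  by rewrite /justified prog_iscode /tag /code_justified /iscode /=
    !(cfst_cpair, csnd_cpair) !inE !eqxx ?orbT.
6: apply: (@certified_justified [:: iscode (encode f)]);
  first (by move=> t; rewrite !inE => /eqP->);
  by rewrite /justified prog_iscode /tag /code_justified /iscode /=
    !(cfst_cpair, csnd_cpair) !inE !eqxx ?orbT.
all: apply: (@certified_justified [::]) => //;
  by rewrite /justified prog_iscode /tag /code_justified /iscode /=
    !(cfst_cpair, csnd_cpair).
Qed.

Lemma certified_halts_justified (l : seq nat) e x y :
  {in l, forall u, certified u} -> halts_justified l e x y ->
  certified (halts e x y).
Proof.
move=> /certified_justified H J; apply: H; rewrite /justified.
by have [-> -> -> ->] := haltsE e x y.
Qed.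

Lemma certified_eval c x y :
  eval no_oracle c x y -> certified (halts (encode c) x y).
Proof.
elim: c x y => [||||| f IHf g IHg | f IHf g IHg | f IHf g IHg | f IHf] x y.
1-5: by move=> /= ->; apply: (@certified_halts_justified [::]) => //;
  rewrite /halts_justified /= !eqxx ?orbT.
- move=> /= [u [v [/IHf fu /IHg gv ->]]].
  apply: (@certified_halts_justified
    [:: halts (encode f) x u; halts (encode g) x v]).
    by move=> t; rewrite !inE => /orP[]/eqP->.
  by rewrite /halts_justified !(cfst_cpair, csnd_cpair) !inE !eqxx ?orbT.
- move=> /= [u /IHg gu /IHf fy].
  apply: (@certified_halts_justified
    [:: halts (encode g) x u; halts (encode f) u y]).
    by move=> t; rewrite !inE => /orP[]/eqP->.
  rewrite /halts_justified !(cfst_cpair, csnd_cpair) /=.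
  by have [_ _ _ ->] := haltsE (encode g) x u; rewrite !inE !eqxx ?orbT.
- rewrite [eval _ _ _ _]/=; move E: (csnd x) => n.
  elim: n x y E => [|n IHn] x y E.
    move=> /= /IHf fy.
    apply: (@certified_halts_justified [:: halts (encode f) (cfst x) y]).
      by move=> t; rewrite !inE => /eqP->.
    by rewrite /halts_justified !(cfst_cpair, csnd_cpair) E !inE !eqxx ?orbT.
  case=> r hr /IHg gy; set x' := cpair (cfst x) n.
  have {}hr : certified (halts (encode (Prec f g)) x' r).
    by apply: IHn; rewrite /x' ?csnd_cpair // cfst_cpair.
  set h := halts _ x' r in hr; set k := halts _ _ _ in gy.
  apply: (@certified_halts_justified [:: h; k]).
    by move=> t; rewrite !inE => /orP[]/eqP->.
  rewrite /halts_justified !(cfst_cpair, csnd_cpair) E /=.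
  have [_ _ _ ->] : [/\ _, _, _ & out h = r] := haltsE _ x' r.
  by rewrite !inE !eqxx ?orbT.
- move=> /= [/IHf fy Hy].
  (* The bound is moved inside, with arbitrary values from [y] on, so that choice yields one total
     function. *)
  have /choice[k Hk] : forall m, exists k,
      m < y -> eval no_oracle f (cpair x m) k.+1.
    move=> m; case: (ltnP m y) => [/Hy[k ?]|]; first by exists k.
    by exists 0.
  pose l := [seq halts (encode f) (cpair x m) (k m).+1 | m <- iota 0 y].
  apply: (@certified_halts_justified (halts (encode f) (cpair x y) 0 :: l)).
    move=> t; rewrite inE => /orP[/eqP->//|/mapP[m]].
    by rewrite mem_iota => /andP[_ /Hk/IHf] ? ->.
  rewrite /halts_justified !(cfst_cpair, csnd_cpair).
  apply/orP; right; rewrite inE !eqxx /=; apply/allP => m my; apply/orP; right.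
  have kl : halts (encode f) (cpair x m) (k m).+1 \in l.
    by apply/mapP; exists m.
  apply/hasP; exists (halts (encode f) (cpair x m) (k m).+1) => //.
  have [_ _ _ ->] := haltsE (encode f) (cpair x m) (k m).+1.
  by rewrite inE kl orbT.
Qed.

(** Halting becomes a search over a decidable relation, as the enumeration below needs. *)
Lemma halting_setP e : halting_set e <-> exists w, halting_witness e w.
Proof.
split=> [[c [<- [y ey]]]|[w /and3P[/allP cert cd /hasP[t _ hl]]]].
  have [|s s_cert ls] := @certified_all
    [:: iscode (encode c); halts (encode c) (encode c) y].
    move=> t; rewrite !inE => /orP[]/eqP->; first exact: certified_code.
    exact: certified_eval.
  exists (encode_seq s); rewrite /halting_witness encode_seqK s_cert /=.
  rewrite ls ?inE ?eqxx //=; apply/hasP.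
  exists (halts (encode c) (encode c) y); first by rewrite ls ?inE ?eqxx ?orbT.
  by have [_ _ _ ->] := haltsE (encode c) (encode c) y;
    rewrite ls ?inE ?eqxx ?orbT.
have [c ec] := code_justified_sound cert cd.
by exists c; split=> //; exists (out t); rewrite -ec in hl *;
  apply: halts_justified_sound hl.
Qed.

(** * The tree of an enumeration *)

Local Open Scope classical_set_scope.

Section Tree.
Context (a : nat -> nat) (a_inj : injective a).

Definition true_stage (s : nat) : Prop := forall t, s < t -> a s < a t.

(** A witness [t] lies beyond the run, because [a t] is strictly below all its values; hence it
    certifies that none of the [k] stages from [i] on is true. *)
Definition below_run (i k t : nat) : bool :=
  (i <= t) && all (fun d => a t < a (i + d)) (iota 0 k).

(** Asking for the least witness leaves at most one code for each branch and height. *)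
Definition is_node (n : nat) : bool :=
  below_run (cfst n) (cfst (csnd n)) (csnd (csnd n)) &&
  all (fun t => ~~ below_run (cfst n) (cfst (csnd n)) t)
      (iota 0 (csnd (csnd n))).

(** The node <i,<k,t>> is the [k]-th element of the chain attached at the
    [i]-th node <i,<0,i>> of the path; storing the witness [t] makes the tree
    decidable. *)
Definition tree : set nat := [set n | is_node n].

Definition branch (n : nat) : nat := cfst n.
Definition height (n : nat) : nat := cfst (csnd n).

Definition code_le (n m : nat) : bool :=
  (height n == 0) && (branch n <= branch m)
  || (branch n == branch m) && (height n <= height m).

Definition tree_le : rel tree := fun x y => code_le (val x) (val y).

Definition br (x : tree) : nat := branch (val x).
Definition ht (x : tree) : nat := height (val x).

Lemma tree_leE (x y : tree) :
  tree_le x y =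
  (ht x == 0) && (br x <= br y) || (br x == br y) && (ht x <= ht y).
Proof. by []. Qed.

(** * Nodes as pairs of branch and height *)

Lemma below_runP i k t :
  reflect (i <= t /\ forall v, i <= v < i + k -> a t < a v) (below_run i k t).
Proof.
apply: (iffP andP) => -[it H]; split=> //.
  move=> v iv; have := allP H (v - i); rewrite mem_iota.
  by rewrite subnKC; [apply; lia | lia].
by apply/allP => d; rewrite mem_iota => dk; apply: H; lia.
Qed.

Definition mk_node n (nodeP : is_node n) : tree :=
  exist (fun n => n \in tree) n (mem_set nodeP).

Lemma node_exists i k : (exists t, below_run i k t) ->
  exists x : tree, br x = i /\ ht x = k.
Proof.
move=> ex; case: (ex_minnP ex) => t bt mint.
have nodet : is_node (cpair i (cpair k t)).
  rewrite /is_node !(csnd_cpair, cfst_cpair) bt /=; apply/allP => u.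
  by rewrite mem_iota => ut; apply/negP => /mint; lia.
exists (mk_node nodet).
by rewrite /br /ht /branch /height /= !(csnd_cpair, cfst_cpair).
Qed.

Lemma tree_nodeP (x : tree) : is_node (val x).
Proof. exact: set_mem (valP x). Qed.

Lemma node_below_run (x : tree) : exists t, below_run (br x) (ht x) t.
Proof. by case/andP: (tree_nodeP x) => b _; eexists; exact: b. Qed.

Lemma tree_node_inj (x y : tree) : br x = br y -> ht x = ht y -> x = y.
Proof.
rewrite /br /ht => brE htE; apply: val_inj.
rewrite -(cpair_eta (val x)) -(cpair_eta (val y)).
rewrite -(cpair_eta (csnd (val x))) -(cpair_eta (csnd (val y))).
move: brE htE (tree_nodeP x) (tree_nodeP y).
rewrite /is_node /branch /height => <- <-.
set t := csnd (csnd (val x)); set u := csnd (csnd (val y)).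
move=> /andP[bt mt] /andP[bu mu].
suff -> : t = u by [].
apply/eqP; rewrite eqn_leq; apply/andP; split; rewrite leqNgt; apply/negP => lt.
  by have := allP mt u; rewrite mem_iota bu => /(_ lt).
by have := allP mu t; rewrite mem_iota bt => /(_ lt).
Qed.

Lemma path_subproof i : is_node (cpair i (cpair 0 i)).
Proof.
rewrite /is_node !(csnd_cpair, cfst_cpair).
apply/andP; split; first by rewrite /below_run leqnn.
apply/allP => u; rewrite mem_iota /below_run => ui.
by apply/negP => /andP[]; lia.
Qed.

Definition path_node i : tree := mk_node (path_subproof i).

Lemma br_path i : br (path_node i) = i.
Proof. by rewrite /br /branch /= cfst_cpair. Qed.

Lemma ht_path i : ht (path_node i) = 0.
Proof. by rewrite /ht /height /= csnd_cpair cfst_cpair. Qed.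

Lemma path_node_eq (x : tree) : ht x = 0 -> x = path_node (br x).
Proof. by move=> hx; apply: tree_node_inj; rewrite ?br_path ?ht_path. Qed.

Lemma path_node_inj : injective path_node.
Proof. by move=> i j /(congr1 br); rewrite !br_path. Qed.

(** * True stages and lengths of chains *)

Lemma below_run_sub i k k' t : k' <= k -> below_run i k t -> below_run i k' t.
Proof.
move=> lek /below_runP[it H]; apply/below_runP; split=> // v iv.
by apply: H; lia.
Qed.

(** Otherwise [s] lies in the run of [x], whose witness [t] then has [a t < a s]. It cannot come
    after the true stage [s]; coming before, it would lie in the run itself and give [a t < a t]. *)
Lemma height_true_stage (x : tree) s :
  true_stage s -> br x <= s -> br x + ht x <= s.
Proof.
move=> ts xs; have [t /below_runP[xt H]] := node_below_run x.
rewrite leqNgt; apply/negP => sx; have /H : br x <= s < br x + ht x by lia.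
case: (ltngtP t s) => [lt|/ts|->]; [|lia|lia].
by have := H t; lia.
Qed.

(** If a stage is not true, injectivity gives a later one with a strictly smaller value, and this
    descent ends. *)
Lemma true_stage_exists N : exists s, [/\ N <= s, true_stage s
  & forall v, N <= v -> true_stage v -> s <= v].
Proof.
have ex : exists s, `[< N <= s /\ true_stage s >].
  suff: forall n s, a s <= n -> N <= s ->
      exists s, `[< N <= s /\ true_stage s >].
    by move/(_ (a N) N); apply.
  elim=> [|n IHn] s as_n Ns;
    have [ts|/existsNP[t /not_implyP[st /negP nlt]]] := pselect (true_stage s);
    try by exists s; apply/asboolP.
    by have := @a_inj s t; lia.
  by apply: (IHn t); have := @a_inj s t; lia.
case: (ex_minnP ex) => s /asboolP[Ns ts] mins; exists s; split=> // v Nv tv.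
by apply: mins; apply/asboolP.
Qed.

(** * Finite and infinite cones *)

Lemma finite_bounded_nodes (A : set tree) b h :
  (forall x, A x -> br x < b /\ ht x < h) -> finite_set A.
Proof.
move=> bnd; pose F (x : tree) := cpair (br x) (ht x).
pose B := (fun p => cpair p.1 p.2) @` (`I_b `*` `I_h).
apply: (@sub_finite_set _ _ (F @^-1` B)).
  by move=> x /bnd[xb xh]; exists (br x, ht x).
apply: finite_preimage; last first.
  by apply/finite_image/finite_setX; exact: finite_II.
by move=> x y _ _ /cpair_inj[? ?]; apply: tree_node_inj.
Qed.

Lemma infinite_path_nodes (A : set tree) i :
  (forall j, i <= j -> A (path_node j)) -> infinite_set A.
Proof.
move=> pA finA; pose F n := path_node (i + n); apply: infinite_nat.
have <- : F @^-1` A = setT.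
  by apply/seteqP; split=> // n _; apply: pA; rewrite leq_addr.
by apply: finite_preimage finA => n m _ _ /path_node_inj; lia.
Qed.

Lemma infinite_cone_path i : infinite_set (cone tree_le (path_node i)).
Proof.
apply: (@infinite_path_nodes _ i) => j ij.
by rewrite /cone /= tree_leE ht_path !br_path ij.
Qed.

(** Above a chain element there is only the rest of its chain, which the next true stage bounds. *)
Lemma finite_cone (x : tree) : 0 < ht x -> finite_set (cone tree_le x).
Proof.
move=> hx; have [s [xs ts _]] := true_stage_exists (br x).
apply: (@finite_bounded_nodes _ (br x).+1 s.+1) => y.
rewrite /cone /= tree_leE; have := height_true_stage (x := y) ts; lia.
Qed.

Lemma is_tree_tree_le : is_tree tree_le.
Proof.
split.
- split=> [x|x y|y x z]; rewrite !tree_leE; first by lia.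
    by move=> H; apply: tree_node_inj; lia.
  by lia.
- exact: countableP.
- by exists (path_node 0) => x; rewrite tree_leE ht_path br_path.
- move=> x; split=> [|y z]; last by rewrite /= !tree_leE; lia.
  apply: (@finite_bounded_nodes _ (br x).+1 (ht x).+1) => y.
  by rewrite /= tree_leE; lia.
Qed.

(** * The main path and type 2 *)

Definition main_path : set tree := range path_node.

Lemma main_pathP (x : tree) : main_path x <-> ht x = 0.
Proof.
split=> [[i _ <-]|/path_node_eq->]; first exact: ht_path.
by exists (br x).
Qed.

Lemma main_path_linear : linearly_ordered tree_le main_path.
Proof.
by move=> x y /main_pathP hx /main_pathP hy; rewrite !tree_leE; lia.
Qed.

(** A chain element in [Q] would be comparable with all of [Q], but only finitely many nodes lie
    below or above it. *)
Lemma infinite_linear_sub (Q : set tree) :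
  linearly_ordered tree_le Q -> infinite_set Q -> Q `<=` main_path.
Proof.
move=> linQ infQ x Qx; apply/main_pathP; apply/eqP; rewrite -leqn0 leqNgt.
apply/negP => hx; apply: infQ.
apply: (@sub_finite_set _ _ ([set y | tree_le y x] `|` cone tree_le x)).
  by move=> y Qy; have [] := linQ _ _ Qx Qy; [right | left].
rewrite finite_setU; split; last exact: finite_cone.
by have [_ _ _ /(_ x)[]] := is_tree_tree_le.
Qed.

Lemma infinite_main_path : infinite_set main_path.
Proof. by apply: (@infinite_path_nodes _ 0) => j _; exists j. Qed.

Lemma main_path_isolated : isolated_path tree_le main_path.
Proof.
split; first split.
- exact: infinite_main_path.
- exact: main_path_linear.
- move=> Q linQ PQ; apply/seteqP; split=> //; apply: infinite_linear_sub => //.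
  by move=> /(sub_finite_set PQ); exact: infinite_main_path.
(* The main path is the only path, so already the root isolates it. *)
- exists (path_node 0); split=> [|Q [infQ linQ maxQ] _]; first by exists 0.
  by apply/esym/maxQ; [exact: main_path_linear | exact: infinite_linear_sub].
Qed.

(** Chain elements have finite cones, and above each path node the next one still has an infinite
    cone. *)
Lemma type2_tree_le : type2 tree_le.
Proof.
split; last by exists main_path; exact: main_path_isolated.
case=> x [infx finx]; have [x0|/finite_cone//] := posnP (ht x).
apply: (@infinite_cone_path (br x).+1); apply: finx.
  by rewrite tree_leE x0 br_path; lia.
by move/(congr1 br); rewrite br_path; lia.
Qed.

(** * Self-embeddings of the tree *)

Section SelfEmbedding.
Context (f : tree -> tree) (f_emb : embedding tree_le tree_le f).

Let f_inj : injective f.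
Proof. by case: f_emb. Qed.

Let f_le x y : tree_le (f x) (f y) = tree_le x y.
Proof.
by case: f_emb => _ fP; apply/idP/idP => H; [exact/fP | exact/(fP x y)].
Qed.

(** Once an image has positive height, everything above it lies in the same chain, and injectivity
    forces a rise of at least one per step. *)
Lemma chain_growth (x y : tree) : br x = br y -> ht x <= ht y -> 0 < ht (f x) ->
  br (f x) = br (f y) /\ ht (f x) + (ht y - ht x) <= ht (f y).
Proof.
move: {2}(ht y - ht x) (erefl (ht y - ht x)) => d; elim: d y => [|d IHd] y.
  by move=> d0 xy lexy _; rewrite (@tree_node_inj x y) //; lia.
move=> dE xy lexy fx0; have [t bt] := node_below_run y.
have [|z [zy hz]] := @node_exists (br y) (ht y).-1.
  by exists t; apply: below_run_sub bt; lia.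
have [] := IHd z; [lia..|]; move=> bz hzx.
have : tree_le (f z) (f y) by rewrite f_le tree_leE; lia.
have fzy : f z <> f y by move/f_inj => zyE; move: hz; rewrite zyE; lia.
rewrite tree_leE; have [hE|] := eqVneq (ht (f z)) (ht (f y)); last by lia.
by move=> H; case: fzy; apply: tree_node_inj => //; lia.
Qed.

(** The infinite cone of a path node cannot be injected into the finite cone of a chain element. *)
Lemma self_embedding_path i : ht (f (path_node i)) = 0.
Proof.
apply/eqP; rewrite -leqn0 leqNgt; apply/negP => h0.
have fincone := finite_cone h0.
apply: (@infinite_cone_path i).
apply: (@sub_finite_set _ _ (f @^-1` cone tree_le (f (path_node i)))).
  by move=> x /=; rewrite /cone /= f_le.
by apply: finite_preimage => // x y _ _; exact: f_inj.
Qed.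

Definition shift i : nat := br (f (path_node i)).

Lemma self_embedding_pathE i : f (path_node i) = path_node (shift i).
Proof. by apply: path_node_eq; exact: self_embedding_path. Qed.

Lemma shift_mono i j : (shift i <= shift j) = (i <= j).
Proof.
have := f_le (path_node i) (path_node j).
by rewrite !self_embedding_pathE !tree_leE !ht_path !br_path; lia.
Qed.

Lemma leq_shift i : i <= shift i.
Proof.
by elim: i => // i IHi; have := shift_mono i.+1 i; rewrite ltnn; lia.
Qed.

(** [x] lies above its path node and is incomparable with the next one. The images keep this, which
    fixes the interval and rules out height 0. *)
Lemma self_embedding_chain (x : tree) : 0 < ht x ->
  0 < ht (f x) /\ shift (br x) <= br (f x) < shift (br x).+1.
Proof.
move=> hx; have := f_le (path_node (br x)) x.
have := f_le (path_node (br x).+1) x; have := f_le x (path_node (br x).+1).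
rewrite !self_embedding_pathE !tree_leE !ht_path !br_path; lia.
Qed.

Lemma leq_height_self_embedding (x : tree) : 0 < ht x -> ht x <= ht (f x).
Proof.
move=> hx; have [t bt] := node_below_run x.
(* The first element of the chain has an image of height at least 1, from which [chain_growth]
   counts upwards. *)
have [|z [zx hz]] := @node_exists (br x) 1.
  by exists t; apply: below_run_sub bt; lia.
have hz0 : 0 < ht z by rewrite hz.
have [fz0 _] := self_embedding_chain hz0.
by have [//||_] := @chain_growth z x _ _ fz0; lia.
Qed.

(** Witnesses are extended one stage at a time, which is possible as long as no true stage has been
    passed. *)
Lemma maximal_chain_node i s : i <= s -> true_stage s ->
    (forall v, i <= v -> true_stage v -> s <= v) ->
  exists x : tree, br x = i /\ ht x = s - i.
Proof.
move=> leis ts mins; apply: node_exists.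
suff: forall k, i + k <= s -> exists t, below_run i k t by apply; lia.
elim=> [_|k IHk iks]; first by exists i; rewrite /below_run leqnn.
have [|t /below_runP[it bt]] := IHk; first by lia.
have [lt|le] := ltnP (a t) (a (i + k)).
  exists t; apply/below_runP; split=> // v iv.
  by have [->//|] := eqVneq v (i + k); have := bt v; lia.
(* As [t] fails at the new stage [i + k], it is replaced by a later [u] with
   [a u < a (i + k) <= a t]. *)
have /existsNP[u /not_implyP[ku /negP nau]] : ~ true_stage (i + k).
  by move/mins; lia.
have auk : a u < a (i + k) by have := @a_inj u (i + k); lia.
exists u; apply/below_runP; split=> [|v iv]; first by lia.
by have [->//|] := eqVneq v (i + k); have := bt v; lia.
Qed.

(** An image that rose within its chain would push the image of the top element of that chain past
    the next true stage. *)
Lemma shift_id_self_embedding : shift =1 id -> f =1 id.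
Proof.
move=> shid x; have [x0|x0] := posnP (ht x).
  by rewrite (path_node_eq x0) self_embedding_pathE shid.
have [fx0] := self_embedding_chain x0; rewrite !shid => brf.
apply: tree_node_inj; first by lia.
apply/eqP; rewrite eqn_leq leq_height_self_embedding // andbT.
have [s [xs ts mins]] := true_stage_exists (br x).
have [z [zx hz]] := maximal_chain_node xs ts mins.
have lexz : ht x <= ht z by have := height_true_stage ts xs; lia.
have [bfz] := @chain_growth x z (esym zx) lexz fx0.
by have := @height_true_stage (f z) s ts; lia.
Qed.

(** If there were no true stage between [i] and [shift i.+1], then the chain at
    [i], which ends at the next true stage, would be longer than the chains at
    all the places where [f] could send it. *)
Lemma true_stage_shift i : i < shift i ->
  exists s, [/\ i <= s, s <= shift i.+1 & true_stage s].
Proof.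
move=> ifi; have [s [leis ts mins]] := true_stage_exists i.
exists s; split=> //; rewrite leqNgt; apply/negP => lts.
have [x [xi hx]] := maximal_chain_node leis ts mins.
have x0 : 0 < ht x by have := shift_mono i.+1 i; lia.
have [fx0] := self_embedding_chain x0; rewrite xi => brf.
have := leq_height_self_embedding x0.
by have := @height_true_stage (f x) s ts; lia.
Qed.

(** Each interval from [N n] to [N n.+1] contains a true stage, and [a] increases strictly along
    true stages. The extra successor in [N] makes the intervals half-open and so disjoint. *)
Lemma true_stages_bound i n : i < shift i ->
  let N n := iter n (fun m => (shift m.+1).+1) i in
  exists s, [/\ N n <= s, s < N n.+1, true_stage s & n <= a s].
Proof.
move=> ifi N; have Nshift m : N m < shift (N m).
  (* Since [shift] is strictly increasing, once it moves [i] it moves every later index. *)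
  have : i <= N m by elim: m => //= m; have := leq_shift (N m).+1; lia.
  elim: (N m) => [|k IHk ik]; first by rewrite leqn0 => /eqP <-.
  have [->//|ik'] := eqVneq k.+1 i.
  by have := shift_mono k.+1 k; have := IHk _; lia.
elim: n => [|n [s [Ns sN ts ns]]].
  have [s [is_ sf ts]] := true_stage_shift (Nshift 0).
  by exists s; split.
have [u [Nu uf tu]] := true_stage_shift (Nshift n.+1).
by exists u; split=> //; have := ts u; lia.
Qed.

End SelfEmbedding.

End Tree.

(** * The enumeration of the halting set *)

Lemma computable_in_tdec O (P : nat -> bool) (A : set nat) :
  tdec O P -> (forall n, A n <-> P n) -> computable_in O A.
Proof.
move=> [c cP] AP; exists c => n; have := cP n.
by case: (P n) (AP n) => /= APn ev; split=> // /APn.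
Qed.

(** The least witness is singled out so that each element is enumerated at one stage only. *)
Definition first_witness (e w : nat) : bool :=
  halting_witness e w && all (fun v => ~~ halting_witness e v) (iota 0 w).

(** An injective enumeration in which the elements of [halting_set] appear,
    doubled, among odd fillers. *)
Definition halting_enum (s : nat) : nat :=
  if first_witness (cfst s) (csnd s) then cfst s + cfst s else (s + s).+1.

Lemma first_witness_uniq e w v :
  first_witness e w -> first_witness e v -> w = v.
Proof.
move=> /andP[ew /allP minw] /andP[ev /allP minv]; case: (ltngtP w v) => // lt.
  by have := minv w; rewrite mem_iota ew => /(_ lt).
by have := minw v; rewrite mem_iota ev => /(_ lt).
Qed.

Lemma halting_enum_inj : injective halting_enum.
Proof.
move=> s t; rewrite /halting_enum; case: ifP => [ws|_]; case: ifP => [wt|_];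
  try lia.
move=> st; have e : cfst s = cfst t by lia.
rewrite -(cpair_eta s) -(cpair_eta t) e; congr cpair.
by apply: first_witness_uniq wt; rewrite -e.
Qed.

(** With [w] the least witness of [e], stage [cpair e w] has value [e + e]. After the true stage [s]
    all values are larger, so [cpair e w], and with it [w], is at most [s]. *)
Lemma halting_set_bounded e s B :
  true_stage halting_enum s -> e + e < halting_enum s -> s < B ->
  halting_set e <-> has (halting_witness e) (iota 0 B).
Proof.
move=> ts es sB; split=> [/halting_setP ex|/hasP[w _ ew]]; last first.
  by apply/halting_setP; exists w.
case: (ex_minnP ex) => w ew minw; apply/hasP; exists w => //.
rewrite mem_iota /= add0n; have := leq_cpair e w.
have enE : halting_enum (cpair e w) = e + e.
  rewrite /halting_enum !(cfst_cpair, csnd_cpair) ifT // /first_witness ew /=.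
  by apply/allP => v; rewrite mem_iota => vw; apply/negP => /minw; lia.
by have := ts (cpair e w); rewrite enE; lia.
Qed.

(** * Computability of the tree *)

Section Computability.
Context (O : nat -> nat).

Lemma tcomp_halting_enum g : tcomp O g -> tcomp O (fun x => halting_enum (g x)).
Proof.
move=> tg; apply: (@tcomp_comp _ halting_enum g) => //.
rewrite /halting_enum /first_witness.
by do ?[tcomp_step | apply: tdec_halting_witness].
Qed.

Lemma tdec_is_node g : tcomp O g ->
  tdec O (fun x => is_node halting_enum (g x)).
Proof.
move=> tg; apply: (@tcomp_comp _ (is_node halting_enum) g) => //.
rewrite /is_node /below_run /leq.
by do ?[tcomp_step | apply: tcomp_halting_enum].
Qed.

Lemma tdec_code_le f g : tcomp O f -> tcomp O g ->
  tdec O (fun x => code_le (f x) (g x)).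
Proof.
by apply: tdec_subst; rewrite /code_le /height /branch; tcomp_auto.
Qed.

End Computability.

Lemma computable_tree_le : computable_tree (@tree_le halting_enum).
Proof.
split.
- exact: is_tree_tree_le.
- apply: (@computable_in_tdec _ (is_node halting_enum)) => //.
  exact: tdec_is_node (tcomp_id _).
- pose P p := [&& is_node halting_enum (cfst p), is_node halting_enum (csnd p)
    & code_le (cfst p) (csnd p)].
  apply: (@computable_in_tdec _ P) => [|p].
    by rewrite /P; do ?[tcomp_step | apply: tdec_is_node | apply: tdec_code_le].
  split=> [[x [y [lexy ->]]]|/and3P[nx ny lexy]].
    by rewrite /P cfst_cpair csnd_cpair !tree_nodeP.
  by exists (mk_node nx), (mk_node ny); split=> //=; rewrite cpair_eta.
Qed.

(** * The halting set from a self-embedding *)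

Lemma self_embedding_computes (f : tree halting_enum -> tree halting_enum) :
  nontrivial_self_embedding (@tree_le halting_enum) f -> computes f halting_set.
Proof.
move=> [f_emb nonsurj].
(* Path nodes have explicit codes, so one oracle query gives [shift]. *)
have shiftE m : shift f m = cfst (extend0 f (cpair m (cpair 0 m))).
  by rewrite /extend0 -[cpair _ _]/(val (path_node halting_enum m)) valK.
(* This [i] is obtained classically and enters the program as a constant. *)
have [i ifi] : exists i, i < shift f i.
  apply: contrapT => /forallNP noshift; apply: nonsurj.
  have fid : f =1 id.
    apply: (shift_id_self_embedding halting_enum_inj f_emb) => i.
    have := leq_shift halting_enum_inj f_emb i.
    by have := noshift i; move/negP; rewrite -leqNgt /=; lia.
  by apply/seteqP; split=> // x _; exists x.
(* [true_stages_bound] is applied with [n = (e + e).+1], so that the true stage has value above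
   [e + e]; that stage is below [N n.+1], hence the second successor. *)
pose B e := iter (e + e).+2 (fun m => (shift f m.+1).+1) i.
pose P e := has (halting_witness e) (iota 0 (B e)).
apply: (@computable_in_tdec _ P) => [|e].
  apply: (@tdec_has _ halting_witness).
    by apply: tdec_halting_witness; tcomp_auto.
  apply: tcomp_iter; last first.
  - by tcomp_auto.
  - exact: tcomp_const.
  apply: (tcomp_ext (g := fun m =>
    (cfst (extend0 f (cpair m.+1 (cpair 0 m.+1)))).+1)).
    by move=> m; rewrite shiftE.
  by do 2!tcomp_step; apply: tcomp_oracle; tcomp_auto.
have [s [_ sB ts es]] :=
  true_stages_bound halting_enum_inj f_emb (e + e).+1 ifi.
exact: halting_set_bounded ts es sB.
Qed.

Theorem theorem4p2 :
  exists (T : set nat) (le : rel T),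
    [/\ computable_tree le,
        type2 le
      & forall f : T -> T,
          nontrivial_self_embedding le f -> computes f halting_set].
Proof.
exists (tree halting_enum), (@tree_le halting_enum); split.
- exact: computable_tree_le.
- exact: type2_tree_le halting_enum_inj.
- exact: self_embedding_computes.
Qed.
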